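(* Let $n\ge 2$ be an integer, let $a,b$ be integers with $0\le a<b\le n-1$ and $\gcd(a,b)=1$, and let $G=\langle A\rangle\subset \mathrm{PGL}_3(\mathbb{C})$ be the cyclic group of order $n$ generated by (the class of) $A=\mathrm{diag}(1,\zeta_n^a,\zeta_n^b)$. Then: (1) $G$ always has a real field of moduli. (2) $\mathbb{R}$ is a field of definition for $G$ if and only if $A$ and $A^{-1}$ are conjugate via a transformation of the shape $\phi\,({}^{\sigma}\phi)^{-1}$ for some $\phi\in \mathrm{PGL}_3(\mathbb{C})$, that is, if and only if there is $\phi\in\mathrm{PGL}_3(\mathbb{C})$ with $$\left(\phi\,({}^{\sigma}\phi)^{-1}\right)^{-1} A\,\left(\phi\,({}^{\sigma}\phi)^{-1}\right)=A^{-1}\quad\text{in }\mathrm{PGL}_3(\mathbb{C}).$$ In this situation, $\phi^{-1}G\,\phi$ is a model for $G$ over $\mathbb{R}$.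
   Context: Here $\zeta_n=e^{2\pi i/n}$, and $\sigma$ is complex conjugation, the generator of $\mathrm{Gal}(\mathbb{C}/\mathbb{R})$, acting entrywise on $\mathrm{PGL}_3(\mathbb{C})$, written $\phi\mapsto{}^{\sigma}\phi$; for a subgroup $G$ put ${}^{\sigma}G=\{{}^{\sigma}g: g\in G\}$. A matrix in $\mathrm{GL}_3(\mathbb{C})$ is identified with its class in $\mathrm{PGL}_3(\mathbb{C})$. $\mathrm{PGL}_3(\mathbb{R})$ is viewed as a subgroup of $\mathrm{PGL}_3(\mathbb{C})$ in the natural way. For a finite subgroup $G\subset\mathrm{PGL}_3(\mathbb{C})$: $G$ has a real field of moduli if ${}^{\sigma}G$ and $G$ are conjugate in $\mathrm{PGL}_3(\mathbb{C})$. $\mathbb{R}$ is a field of definition for $G$ (equivalently, $G$ is definable over $\mathbb{R}$) if $G$ is $\mathrm{PGL}_3(\mathbb{C})$-conjugate to some $G'\subset\mathrm{PGL}_3(\mathbb{R})$; such a $G'$ is called a model for $G$ over $\mathbb{R}$. *)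

(* Defs.v *)
From HB Require Import structures.
From mathcomp Require Import all_boot all_order all_algebra.
From mathcomp Require Import complex.
From mathcomp Require Import boolp classical_sets reals trigo.
From mathcomp Require Import lra.

Set Implicit Arguments.
Unset Strict Implicit.
Unset Printing Implicit Defensive.

Import Order.TTheory GRing.Theory Num.Theory.

Local Open Scope ring_scope.
Local Open Scope classical_set_scope.
Local Open Scope quotient_scope.

(* MathComp's {'GL_n[F]} is only available over finite rings, hence the
   following groups GL_n(F) and PGL_n(F) over an arbitrary field. *)

Record GL (F : fieldType) (n : nat) : Type :=
  GLmx { GLmat : 'M[F]_n; _ : GLmat \in unitmx }.

HB.instance Definition _ (F : fieldType) (n : nat) :=
  [isSub for @GLmat F n].
HB.instance Definition _ (F : fieldType) (n : nat) :=
  [Choice of GL F n by <:].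

Section GLGroup.
Variables (F : fieldType) (n : nat).
Implicit Types A B C : GL F n.

Fact GLone_subproof : (1%:M : 'M[F]_n) \in unitmx.
Proof. exact: unitmx1. Qed.

Fact GLmul_subproof A B : GLmat A *m GLmat B \in unitmx.
Proof. by rewrite unitmx_mul (valP A) (valP B). Qed.

Fact GLinv_subproof A : invmx (GLmat A) \in unitmx.
Proof. by rewrite unitmx_inv (valP A). Qed.

Definition GLone : GL F n := GLmx GLone_subproof.
Definition GLmul A B : GL F n := GLmx (GLmul_subproof A B).
Definition GLinv A : GL F n := GLmx (GLinv_subproof A).

Fact GLmulA : associative GLmul.
Proof. by move=> A B C; apply: val_inj; rewrite /= mulmxA. Qed.

Fact GLmul1 : left_id GLone GLmul.
Proof. by move=> A; apply: val_inj; rewrite /= mul1mx. Qed.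

Fact GLmulr1 : right_id GLone GLmul.
Proof. by move=> A; apply: val_inj; rewrite /= mulmx1. Qed.

Fact GLmulV : left_inverse GLone GLinv GLmul.
Proof. by move=> A; apply: val_inj; rewrite /= mulVmx // (valP A). Qed.

Fact GLmulrV : right_inverse GLone GLinv GLmul.
Proof. by move=> A; apply: val_inj; rewrite /= mulmxV // (valP A). Qed.

HB.instance Definition _ :=
  isGroup.Build (GL F n) GLmulA GLmul1 GLmulr1 GLmulV GLmulrV.

Definition GLproportional A B : bool :=
  `[< exists2 c : F, c != 0 & GLmat A = c *: GLmat B >].

Fact GLproportional_refl : reflexive GLproportional.
Proof. by move=> A; apply/asboolP; exists 1; rewrite ?oner_eq0 ?scale1r. Qed.

Fact GLproportional_sym : symmetric GLproportional.
Proof.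
move=> A B; apply/asboolP/asboolP=> -[c c0 e]; exists c^-1;
  by rewrite ?invr_eq0 // e scalerA mulVf // scale1r.
Qed.

Fact GLproportional_trans : transitive GLproportional.
Proof.
move=> B A C /asboolP[c c0 eA] /asboolP[d d0 eB]; apply/asboolP.
by exists (c * d); rewrite ?mulf_neq0 // eA eB scalerA.
Qed.

Canonical GLproportional_equiv := EquivRel GLproportional
  GLproportional_refl GLproportional_sym GLproportional_trans.

Definition PGL : Type := {eq_quot GLproportional}.

HB.instance Definition _ := Choice.on PGL.
HB.instance Definition _ := EqQuotient.on PGL.

Definition PGLclass A : PGL := \pi_PGL A.

Lemma PGLclassP A B :
  PGLclass A = PGLclass B <->
  exists2 c : F, c != 0 & GLmat A = c *: GLmat B.
Proof.
rewrite /PGLclass; split=> [/eqmodP/asboolP //|AB].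
by apply/eqmodP/asboolP.
Qed.

Definition PGLone : PGL := PGLclass 1%g.
Definition PGLmul (x y : PGL) : PGL := PGLclass (repr x * repr y)%g.
Definition PGLinv (x : PGL) : PGL := PGLclass (repr x)^-1%g.

Lemma PGLrepr A :
  exists2 c : F, c != 0 & GLmat (repr (PGLclass A)) = c *: GLmat A.
Proof. by apply/PGLclassP; rewrite /PGLclass reprK. Qed.

Lemma PGLmulE A B : PGLmul (PGLclass A) (PGLclass B) = PGLclass (A * B)%g.
Proof.
have [c c0 eA] := PGLrepr A; have [d d0 eB] := PGLrepr B.
apply/PGLclassP; exists (c * d); first by rewrite mulf_neq0.
by rewrite /= eA eB -scalemxAl -scalemxAr scalerA.
Qed.

Lemma PGLinvE A : PGLinv (PGLclass A) = PGLclass A^-1%g.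
Proof.
have [c c0 eA] := PGLrepr A.
apply/PGLclassP; exists c^-1; first by rewrite invr_eq0.
have uA : c *: GLmat A \in unitmx by rewrite -eA; apply: valP.
by rewrite /= eA invmxZ.
Qed.

Lemma PGLind (P : PGL -> Prop) : (forall A, P (PGLclass A)) -> forall x, P x.
Proof. by move=> PA x; rewrite -[x]reprK; apply: PA. Qed.

Fact PGLmulA : associative PGLmul.
Proof.
elim/PGLind=> A; elim/PGLind=> B; elim/PGLind=> C.
by rewrite !PGLmulE mulgA.
Qed.

Fact PGLmul1 : left_id PGLone PGLmul.
Proof. by elim/PGLind=> A; rewrite PGLmulE mul1g. Qed.

Fact PGLmulr1 : right_id PGLone PGLmul.
Proof. by elim/PGLind=> A; rewrite PGLmulE mulg1. Qed.

Fact PGLmulV : left_inverse PGLone PGLinv PGLmul.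
Proof. by elim/PGLind=> A; rewrite PGLinvE PGLmulE mulVg. Qed.

Fact PGLmulrV : right_inverse PGLone PGLinv PGLmul.
Proof. by elim/PGLind=> A; rewrite PGLinvE PGLmulE mulgV. Qed.

HB.instance Definition _ :=
  isGroup.Build PGL PGLmulA PGLmul1 PGLmulr1 PGLmulV PGLmulrV.

Lemma PGLclassM A B : PGLclass (A * B)%g = (PGLclass A * PGLclass B)%g.
Proof. by rewrite -PGLmulE. Qed.

Lemma PGLclassV A : PGLclass A^-1%g = (PGLclass A)^-1%g.
Proof. by rewrite -PGLinvE. Qed.

End GLGroup.

Section PGLMap.
Variables (F K : fieldType) (n : nat) (f : {rmorphism F -> K}).

Fact GLmap_subproof (A : GL F n) : map_mx f (GLmat A) \in unitmx.
Proof. by rewrite map_unitmx (valP A). Qed.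

Definition GLmap (A : GL F n) : GL K n := GLmx (GLmap_subproof A).

(* The entrywise action of f; GLmap_class shows that it does not depend on
   the chosen representative. *)
Definition PGLmap (x : PGL F n) : PGL K n := PGLclass (GLmap (repr x)).

Lemma GLmap_class A : PGLmap (PGLclass A) = PGLclass (GLmap A).
Proof.
have [c c0 eA] := PGLrepr A; apply/PGLclassP.
by exists (f c); rewrite ?fmorph_eq0 //= eA map_mxZ.
Qed.

Fact PGLmap_div : {morph PGLmap : x y / (x / y)%g}.
Proof.
elim/PGLind=> A; elim/PGLind=> B.
rewrite -PGLclassV -PGLclassM !GLmap_class -PGLclassV -PGLclassM.
congr PGLclass; apply: val_inj.
by rewrite /= map_mxM map_invmx.
Qed.

HB.instance Definition _ :=
  isGroupMorphism.Build (PGL F n) (PGL K n) PGLmap PGLmap_div.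

End PGLMap.

Section Fields.
Variable R : realType.

Definition sigma : PGL R[i] 3 -> PGL R[i] 3 :=
  PGLmap (conjc : {rmorphism R[i] -> R[i]}).

Definition PGL3_real : set (PGL R[i] 3) :=
  range (PGLmap (real_complex R : {rmorphism R -> R[i]})).

Definition conjugate_set (G : set (PGL R[i] 3)) (phi : PGL R[i] 3) :
    set (PGL R[i] 3) :=
  [set (phi^-1 * g * phi)%g | g in G].

Definition conjugate_in_PGL (G H : set (PGL R[i] 3)) : Prop :=
  exists phi : PGL R[i] 3, conjugate_set G phi = H.

(* The following notions are meant for G a finite subgroup. *)
Definition has_real_field_of_moduli (G : set (PGL R[i] 3)) : Prop :=
  conjugate_in_PGL (sigma @` G) G.

Definition is_real_model (G G' : set (PGL R[i] 3)) : Prop :=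
  G' `<=` PGL3_real /\ conjugate_in_PGL G G'.

Definition definable_over_R (G : set (PGL R[i] 3)) : Prop :=
  exists G' : set (PGL R[i] 3), is_real_model G G'.

(* exp (2 i pi / n) *)
Definition zeta (n : nat) : R[i] :=
  (cos (2 * pi / n%:R) +i* sin (2 * pi / n%:R))%C.

Definition diag3 (x y z : R[i]) : 'M[R[i]]_3 :=
  diag_mx (\row_(j < 3) [:: x; y; z]`_j).

Fact zeta_neq0 (n : nat) : zeta n != 0.
Proof.
apply/eqP=> -[c0 s0]; have := cos2Dsin2 (2 * pi / n%:R : R).
by rewrite c0 s0 expr0n /= addr0 => /eqP; rewrite eq_sym oner_eq0.
Qed.

Fact diagA_unitmx (n a b : nat) :
  diag3 1 (zeta n ^+ a) (zeta n ^+ b) \in unitmx.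
Proof.
rewrite unitmxE det_diag unitfE !big_ord_recl big_ord0 !mxE /=.
by rewrite !mulf_neq0 ?oner_eq0 ?expf_neq0 ?zeta_neq0.
Qed.

(* The class of diag (1, zeta_n^a, zeta_n^b). *)
Definition diagA (n a b : nat) : PGL R[i] 3 :=
  PGLclass (GLmx (diagA_unitmx n a b)).

End Fields.

Section Order.
Variable R : realType.

Lemma zetaX (n k : nat) :
  zeta R n ^+ k =
  (cos (2 * pi / n%:R *+ k) +i* sin (2 * pi / n%:R *+ k))%C.
Proof.
elim: k => [|k IHk]; first by rewrite expr0 mulr0n cos0 sin0.
rewrite exprS IHk /zeta; set x := 2 * pi / _.
rewrite (mulrS x) cosD sinD; set y := x *+ k.
by apply/eqP; rewrite eq_complex /= [sin x * _ + _]addrC !eqxx.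
Qed.

Lemma zeta_primitive (n : nat) : (0 < n)%N -> n.-primitive_root (zeta R n).
Proof.
move=> n0; have n0R : 0 < n%:R :> R by rewrite ltr0n.
have zn : zeta R n ^+ n = 1.
  rewrite zetaX -[_ *+ n]mulr_natr mulfVK ?gt_eqF // mulr_natl.
  by rewrite cos2pi sin2pi.
have [m zm mn] := prim_order_exists n0 zn.
have := prim_expr_order zm; rewrite zetaX => -[].
have m0 := prim_order_gt0 zm; pose x : R := pi / n%:R *+ m.
have -> : 2 * pi / n%:R *+ m = x *+ 2 :> R.
  by rewrite -mulrA mulr_natl mulrnAC.
rewrite cos_mulr2n cos2sin2 => c1 _.
have sx : sin x = 0.
  suff /eqP : sin x ^+ 2 = 0 by rewrite expf_eq0 /= => /eqP.
  by move: c1; lra.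
have [mltn|] := ltnP m n; last first.
  by move=> nm; suff {1}-> : n = m by []; apply/eqP; rewrite eqn_leq nm (dvdn_leq n0 mn).
suff /sin_gt0_pi : 0 < x < pi by rewrite sx ltxx.
rewrite pmulrn_lgt0 // divr_gt0 ?pi_gt0 //= /x -mulr_natr -mulrA.
by rewrite gtr_pMr ?pi_gt0 // mulrC ltr_pdivrMr // mul1r ltr_nat.
Qed.

(* Hence the subgroup generated by diagA R n a b is cyclic of order n. *)
Lemma diagA_order (n a b k : nat) : (0 < n)%N -> coprime a b ->
  (diagA R n a b ^+ k)%g = 1%g <-> (n %| k)%N.
Proof.
move=> n0 cop; have zP := zeta_primitive n0.
set D := GLmx (diagA_unitmx R n a b).
have DX : GLmat (D ^+ k)%g = diag3 1 (zeta R n ^+ (a * k)) (zeta R n ^+ (b * k)).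
  elim: k => [|k IHk].
    rewrite !muln0 /= -diag_const_mx /diag3; congr diag_mx.
    by apply/rowP=> -[[|[|[]]] ?] //; rewrite !mxE.
  rewrite expgS /= IHk /diag3 mulmx_diag; congr diag_mx.
  by apply/rowP=> -[[|[|[]]] ?] //; rewrite !mxE /= ?mulr1 // -exprD mulnS.
have AX : (diagA R n a b ^+ k)%g = PGLclass (D ^+ k)%g.
  by elim: (k) => [|j IHj]; rewrite ?expg0 // !expgS IHj PGLclassM.
rewrite AX; split=> [/PGLclassP[c _ /matrixP e]|nk].
  move: (e 0 0) (e 1 1) (e ord_max ord_max).
  rewrite DX !mxE /= !mulr1n !mulr1 => <- /eqP za /eqP zb.
  rewrite -(mul1n k) -(eqP cop) muln_gcdl dvdn_gcd.
  by rewrite !(prim_order_dvd zP) za zb.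
apply/PGLclassP; exists 1; rewrite ?oner_eq0 // scale1r DX /=.
have zX c : zeta R n ^+ (c * k) = 1.
  by apply/eqP; rewrite -(prim_order_dvd zP) dvdn_mull.
rewrite !zX -diag_const_mx /diag3; congr diag_mx.
by apply/rowP=> -[[|[|[]]] ?] //; rewrite !mxE.
Qed.

End Order.

Definition cyclic_subgroup (gT : groupType) (g : gT) : set gT :=
  [set x | exists k : nat, x = (g ^+ k)%g \/ x = (g ^- k)%g].

(* Main.v *)
From HB Require Import structures.
Require Import Defs.
From mathcomp Require Import all_boot all_order all_algebra.
From mathcomp Require Import complex.
From mathcomp Require Import boolp classical_sets reals.
From mathcomp Require Import trigo.

(** Everything rests on two facts.

    Since the entries of [A] are roots of unity, complex conjugation inverts
    them, so [sigma A = A^-1] ([sigma_diagA]).  In particular [sigma] maps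
    [G = <A>] onto itself, so the trivial transformation already realizes the
    field of moduli.

    A class of PGL_3(C) is fixed by [sigma] exactly when it is the class of a
    real matrix ([sigma_fixedP]): if conjugating a matrix rescales it, then
    dividing it by one of its nonzero entries makes it real.  So [phi^-1 A phi]
    is real if and only if [sigma] fixes it, which, by the first fact, reads
    [sigma(phi)^-1 A^-1 sigma(phi) = phi^-1 A phi]; moving everything to one
    side, this is the required conjugation of [A] into [A^-1] by
    [phi sigma(phi)^-1] ([conj_fixedP]).  Finally, [phi^-1 G phi] is generated
    by [phi^-1 A phi], so it consists of real classes as soon as its generator
    is real. *)

Set Implicit Arguments.
Unset Strict Implicit.
Unset Printing Implicit Defensive.

Import GRing.Theory Num.Theory.

Local Open Scope ring_scope.
Local Open Scope classical_set_scope.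

Section Groups.
Local Open Scope group_scope.

Lemma cyclic_subgroup_gen (gT : groupType) (g : gT) : cyclic_subgroup g g.
Proof. by exists 1%N; left; rewrite expg1. Qed.

Lemma cyclic_subgroupV (gT : groupType) (g : gT) :
  cyclic_subgroup g^-1 = cyclic_subgroup g.
Proof.
by apply/seteqP; split=> x [k [->|->]]; exists k; rewrite expVgn ?invgK; auto.
Qed.

Lemma image_cyclic_subgroup (gT hT : groupType)
    (f : UMagmaMorphism.type gT hT) (g : gT) :
  f @` cyclic_subgroup g = cyclic_subgroup (f g).
Proof.
apply/seteqP; split=> [_ [x [k [->|->]] <-]|x [k [->|->]]].
- by exists k; left; rewrite gmulfXn.
- by exists k; right; rewrite gmulfXVn.
- by exists (g ^+ k); [exists k; left | rewrite gmulfXn].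
- by exists (g ^- k); [exists k; right | rewrite gmulfXVn].
Qed.

(** As [s] inverts [A], both equations say that [s phi] conjugates [A^-1] to
    what [phi] conjugates [A] to. *)
Lemma conj_fixedP (gT : groupType) (s : UMagmaMorphism.type gT gT)
    (A phi : gT) :
  s A = A^-1 ->
  s (A ^ phi) = A ^ phi <->
  (phi * (s phi)^-1)^-1 * A * (phi * (s phi)^-1) = A^-1.
Proof.
move=> sA; rewrite -mulgA -conjgE conjgM gmulfJ sA.
by split=> [<-|<-]; rewrite ?conjgK ?conjgKV.
Qed.

End Groups.

(** Normalizing one nonzero entry of [M] to 1 kills the scalar by which [f]
    rescales [M]. *)
Lemma PGLmap_fixed_repr (F : fieldType) (n : nat) (f : {rmorphism F -> F})
    (x : PGL F n.+1) :
  PGLmap f x = x ->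
  exists2 M : GL F n.+1, PGLclass M = x & map_mx f (GLmat M) = GLmat M.
Proof.
elim/PGLind: x => M; rewrite GLmap_class => /PGLclassP[c c0 /= fM].
have [[i j] m0] : exists ij, GLmat M ij.1 ij.2 != 0.
  have M0 : GLmat M != 0.
    by apply/eqP => M0; have := valP M; rewrite /= M0 unitmxE det0 unitr0.
  apply: contrapT => nz; case/eqP: M0; apply/matrixP => i j; rewrite mxE.
  by apply/eqP; apply: contra_notT nz => nz; exists (i, j).
rewrite /= in m0; set m := GLmat M i j in m0.
have uN : m^-1 *: GLmat M \in unitmx.
  by rewrite unitmxZ ?unitfE ?invr_eq0 //; exact: valP.
exists (GLmx uN).
  by apply/PGLclassP; exists m^-1; rewrite ?invr_eq0.
have fm : f m = c * m by have /matrixP/(_ i j) := fM; rewrite !mxE.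
by rewrite /= map_mxZ fM fmorphV fm scalerA invfM mulrAC mulVf // mul1r.
Qed.

Section Sigma.
Variable R : realType.
Implicit Types x : PGL R[i] 3.

Lemma sigma_fixedP x : sigma x = x <-> PGL3_real x.
Proof.
split=> [/PGLmap_fixed_repr[M <- fM]|[y _ <-]]; last first.
  elim/PGLind: y => M; rewrite GLmap_class /sigma GLmap_class.
  congr PGLclass; apply: val_inj; apply/matrixP => i j.
  by rewrite !mxE /= oppr0.
pose N := map_mx (@complex.Re R) (GLmat M).
have NM : map_mx (real_complex R) N = GLmat M.
  apply/matrixP => i j; have /matrixP/(_ i j) := fM; rewrite !mxE.
  by case: (GLmat M i j) => u v [/eqP]; rewrite eqNr => /eqP ->.
have uN : N \in unitmx by rewrite -(map_unitmx (real_complex R)) NM (valP M).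
exists (PGLclass (GLmx uN)) => //.
by rewrite GLmap_class; congr PGLclass; apply: val_inj.
Qed.

Lemma conjc_zeta (n : nat) : conjc (zeta R n) = (zeta R n)^-1.
Proof.
apply: (mulfI (zeta_neq0 R n)); rewrite divff ?zeta_neq0 // /zeta.
apply/eqP; rewrite eq_complex /= !mulrN opprK -!expr2 cos2Dsin2.
by rewrite mulrC addNr !eqxx.
Qed.

Lemma sigma_diagA (n a b : nat) : sigma (diagA R n a b) = ((diagA R n a b)^-1)%g.
Proof.
have zX k : conjc (zeta R n ^+ k) * zeta R n ^+ k = 1.
  rewrite (rmorphXn conjc) [X in X ^+ _]conjc_zeta -exprMn mulVf ?zeta_neq0 //.
  by rewrite expr1n.
apply/eqP; rewrite -mulg_eq1; apply/eqP.
rewrite /sigma /diagA GLmap_class -PGLclassM; congr PGLclass.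
apply: val_inj; rewrite /= /diag3 map_diag_mx mulmx_diag -diag_const_mx.
congr diag_mx; apply/rowP=> -[[|[|[]]] ?] //; rewrite !mxE /=.
- by rewrite mulr1 oppr0.
- by rewrite zX.
- by rewrite zX.
Qed.

Lemma conjugate_cyclic_subgroup (A phi : PGL R[i] 3) :
  conjugate_set (cyclic_subgroup A) phi = cyclic_subgroup (A ^ phi)%g.
Proof.
have conjF : {morph (fun x => x ^ phi)%g : x y / (x / y)%g}.
  by move=> x y /=; rewrite conjMg conjVg.
pose conj : UMagmaMorphism.type (PGL R[i] 3) (PGL R[i] 3) :=
  HB.pack (fun x => x ^ phi)%g (isGroupMorphism.Build _ _ _ conjF).
rewrite -(image_cyclic_subgroup conj A) /conjugate_set.
by apply: eq_imagel => x _; rewrite /= conjgE mulgA.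
Qed.

Lemma cyclic_subgroup_real (B : PGL R[i] 3) :
  sigma B = B -> cyclic_subgroup B `<=` @PGL3_real R.
Proof.
move=> sB x [k xE]; apply/sigma_fixedP.
by case: xE => ->; rewrite /sigma ?gmulfXVn ?gmulfXn /= -/(sigma B) sB.
Qed.

End Sigma.

Theorem theorem2p1 (R : realType) (n a b : nat)
    (n_ge2 : (2 <= n)%N) (ltab : (a < b)%N) (leb : (b <= n - 1)%N)
    (cop : gcdn a b = 1%N) :
  let A : PGL R[i] 3 := diagA R n a b in
  let G : set (PGL R[i] 3) := cyclic_subgroup A in
  has_real_field_of_moduli G /\
  (definable_over_R G <->
   exists phi : PGL R[i] 3,
     ((phi * (sigma phi)^-1)^-1 * A * (phi * (sigma phi)^-1) = A^-1)%g) /\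
  (forall phi : PGL R[i] 3,
     ((phi * (sigma phi)^-1)^-1 * A * (phi * (sigma phi)^-1) = A^-1)%g ->
     is_real_model G (conjugate_set G phi)).
Proof.
move=> A G; have sA : sigma A = (A^-1)%g := sigma_diagA R n a b.
have model phi :
    ((phi * (sigma phi)^-1)^-1 * A * (phi * (sigma phi)^-1) = A^-1)%g ->
    is_real_model G (conjugate_set G phi).
  move=> /(conj_fixedP phi sA) fixA; split; last by exists phi.
  by rewrite conjugate_cyclic_subgroup; apply: cyclic_subgroup_real.
split; last split=> //.
- exists 1%g; rewrite (image_cyclic_subgroup _ A) /= -/(sigma A) sA.
  by rewrite cyclic_subgroupV conjugate_cyclic_subgroup conjg1.
- split=> [[G' [realG' [phi defG']]]|[phi /model]]; last first.
    by exists (conjugate_set G phi).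
  exists phi; apply/(conj_fixedP phi sA)/sigma_fixedP/realG'.
  by rewrite -defG' conjugate_cyclic_subgroup; apply: cyclic_subgroup_gen.
Qed.
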